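(* Let $\mathcal{M}$ be a $d$-dimensional $C^\infty$ compact Riemannian manifold without boundary, let $m\in\mathbb{Z}_+$, and let $r^0<\ldots<r^m$ and $k$ be real numbers (superscripts are indices) and $\lambda_0,\ldots,\lambda_m>0$ be such that $\lambda_0+\ldots+\lambda_m=1$ and $k=\lambda_0r^0+\ldots+\lambda_mr^m$. Then for every $x\in H_0^{2r^m}(\mathcal{M})$ there holds the sharp inequality $$\|\Delta^kx\|_{L_2(\mathcal{M})}\leqslant\prod_{j=0}^m\|\Delta^{r^j}x\|_{L_2(\mathcal{M})}^{\lambda_j}.$$ Each of the eigenfunctions $\varphi_1,\varphi_2,\ldots$ turns this inequality into equality.
   Context: $\mathbb{Z}_+$ is the set of non-negative integers. $\mathcal{M}$ carries its Riemannian volume measure $\mu_g$, $L_2(\mathcal{M})=L_2(\mathcal{M},\mu_g)$ (complex-valued functions). $\Delta$ is the positive self-adjoint Laplace–Beltrami operator ($-\mathrm{div}\,\mathrm{grad}$) on $L_2(\mathcal{M})$; its eigenvalues counted with multiplicity are $0=\mu_0^2<\mu_1^2\leqslant\mu_2^2\leqslant\ldots$ (in particular $\mathcal{M}$ is connected), and $\{\varphi_j\}_{j=0}^\infty$ is an $L_2$-orthonormal basis of real $C^\infty$ eigenfunctions, $\Delta\varphi_j=\mu_j^2\varphi_j$. For $x\in L_2(\mathcal{M})$ put $a_j=(x,\varphi_j)_{L_2(\mathcal{M})}$. For $s\in\mathbb{R}$, $H^s(\mathcal{M})$ is the set of functions $x$ with $\sum_{j=1}^\infty|a_j|^2\mu_j^{2s}<\infty$,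 and $H_0^s(\mathcal{M}):=\{x\in H^s(\mathcal{M}):a_0=0\}$. For $x\in H_0^{2s}(\mathcal{M})$, $\Delta^sx:=\sum_{j=1}^\infty a_j\mu_j^{2s}\varphi_j$. Sharp means that the constant $1$ in front of the product cannot be reduced. *)

(* Defs.v *)
From HB Require Import structures.
From mathcomp Require Import all_boot all_order all_algebra complex.
From mathcomp Require Import all_classical all_reals all_analysis.

Set Implicit Arguments.
Unset Strict Implicit.
Unset Printing Implicit Defensive.

Import Order.TTheory GRing.Theory Num.Theory.
Import numFieldNormedType.Exports.

Local Open Scope classical_set_scope.
Local Open Scope ring_scope.
Local Open Scope complex_scope.

Section Calculus.
Context {R : realType} {d : nat}.
Implicit Types (D : set 'rV[R]_d) (F : 'rV[R]_d -> R) (G : 'rV[R]_d -> 'M[R]_d).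

Definition basis_vec (a : 'I_d) : 'rV[R]_d := delta_mx 0 a.

Definition iter_partial (s : seq 'I_d) F : 'rV[R]_d -> R :=
  foldr (fun a H => 'D_(basis_vec a) H) F s.

(* To be used with D open, where the partial derivatives at a point of D do not
   depend on the values of F outside D. *)
Definition smooth_on D F : Prop :=
  forall (s : seq 'I_d) (v : 'rV[R]_d), D v ->
    {for v, continuous (iter_partial s F)} /\
    (forall a : 'I_d, derivable (iter_partial s F) v (basis_vec a)).

Definition vol_density G (v : 'rV[R]_d) : R := Num.sqrt (\det (G v)).

(* - div grad in local coordinates, for the metric tensor G:
   - |G|^(-1/2) \sum_a d_a (|G|^(1/2) \sum_b G^(ab) d_b F) *)
Definition laplace_coord G F (v : 'rV[R]_d) : R :=
  - ((vol_density G v)^-1 *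
     \sum_(a < d) 'D_(basis_vec a)
       (fun w : 'rV[R]_d => vol_density G w *
          \sum_(b < d) invmx (G w) a b * 'D_(basis_vec b) F w) v).

End Calculus.

(* Integral over R^d, with respect to Lebesgue measure, of a nonnegative Borel
   function, as an iterated one-dimensional Lebesgue integral (Tonelli). *)
Fixpoint integral_rV {R : realType} (d : nat) : ('rV[R]_d -> \bar R) -> \bar R :=
  match d with
  | 0 => fun f => f 0
  | d'.+1 => fun f => (\int[lebesgue_measure]_(t in [set: R])
      integral_rV (fun v : 'rV[R]_d' => f (row_mx (t%:M : 'rV[R]_1) v)))%E
  end.

(* The smooth structure is given by an atlas (I, U_i, phi_i), with U_i =
   chart_dom i, phi_i = chart i and phi_i^-1 = param i; since the charts are
   onto open subsets of R^d there is no boundary. metric i v is the matrix of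
   the metric tensor in the coordinates of the chart i, at the point with
   coordinates v. The distinguished point of the carrier plays no role: it only
   says that the manifold is nonempty. *)
Record riemannian_manifold (R : realType) (d : nat) := RiemannianManifold {
  carrier :> ptopologicalType ;
  chart_index : Type ;
  chart_dom : chart_index -> set carrier ;
  chart : chart_index -> carrier -> 'rV[R]_d ;
  param : chart_index -> 'rV[R]_d -> carrier ;
  metric : chart_index -> 'rV[R]_d -> 'M[R]_d ;
  manifold_hausdorff : hausdorff_space carrier ;
  manifold_second_countable : @second_countable carrier ;
  chart_dom_open : forall i, open (chart_dom i) ;
  chart_cover : \bigcup_(i in [set: chart_index]) chart_dom i = [set: carrier] ;
  chart_im_open : forall i, open (chart i @` chart_dom i) ;
  chartK : forall i p, chart_dom i p -> param i (chart i p) = p ;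
  chart_continuous : forall i, {within chart_dom i, continuous (chart i)} ;
  param_continuous : forall i,
    {within chart i @` chart_dom i, continuous (param i)} ;
  transition_smooth : forall i j (c : 'I_d),
    smooth_on (chart i @` (chart_dom i `&` chart_dom j))
      (fun v => chart j (param i v) 0 c) ;
  metric_smooth : forall i (a b : 'I_d),
    smooth_on (chart i @` chart_dom i) (fun v => metric i v a b) ;
  metric_sym : forall i v, (chart i @` chart_dom i) v ->
    (metric i v)^T = metric i v ;
  metric_pos : forall i v, (chart i @` chart_dom i) v ->
    forall u : 'rV[R]_d, u != 0 -> 0 < (u *m metric i v *m u^T) 0 0 ;
  (* ('J f v) a c is the a-th partial derivative of the c-th component of f *)
  metric_transition : forall i j v,
    (chart i @` (chart_dom i `&` chart_dom j)) v ->
    metric i v =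
      jacobian (chart j \o param i) v *m metric j (chart j (param i v)) *m
      (jacobian (chart j \o param i) v)^T
}.
Arguments chart_dom {R d M} i : rename.
Arguments chart {R d M} i p : rename.
Arguments param {R d M} i v : rename.
Arguments metric {R d M} i v : rename.

Notation borel T := (g_sigma_algebraType (@open T)).

Section RiemannianGeometry.
Context {R : realType} {d : nat} (M : riemannian_manifold R d).

Definition is_volume_measure (mu : {measure set (borel M) -> \bar R}) : Prop :=
  forall (i : chart_index M) (A : set (borel M)),
    measurable A -> A `<=` chart_dom i ->
    mu A = integral_rV (fun v : 'rV[R]_d =>
      (\1_(chart i @` A) v * vol_density (metric i) v)%:E).

Definition smooth_fun (f : M -> R) : Prop :=
  forall i : chart_index M,
    smooth_on (chart i @` chart_dom i) (fun v => f (param i v)).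

(* h is the image of the smooth function f under - div grad *)
Definition is_laplacian (f h : M -> R) : Prop :=
  forall (i : chart_index M) (p : M), chart_dom i p ->
    laplace_coord (metric i) (fun v => f (param i v)) (chart i p) = h p.

End RiemannianGeometry.

Local Notation normc := ComplexField.Normc.normc.

Section L2.
Context {R : realType} {disp : measure_display} {T : measurableType disp}.
Variable mu : {measure set T -> \bar R}.
Implicit Types x y : T -> R[i].

Definition L2_enorm x : \bar R := Lnorm mu 2%:E (fun p => (normc (x p))%:E).

Definition in_L2 x : Prop :=
  [/\ measurable_fun setT (fun p => complex.Re (x p)),
      measurable_fun setT (fun p => complex.Im (x p)) &
      (L2_enorm x < +oo)%E].

Definition L2_norm x : R := fine (L2_enorm x).

Definition L2_inner x y : R[i] :=
  (\int[mu]_p complex.Re (x p * (y p)^*))%R +i*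
  (\int[mu]_p complex.Im (x p * (y p)^*))%R.

Definition L2_limit (u : nat -> T -> R[i]) y : Prop :=
  (fun N : nat => L2_norm (fun p => u N p - y p)) @ \oo --> (0 : R).

Variables (ev : nat -> R) (phi : nat -> T -> R).

Definition cphi (j : nat) : T -> R[i] := fun p => (phi j p)%:C.

Definition fourier_coef x (j : nat) : R[i] := L2_inner x (cphi j).

Definition orthonormal_basis : Prop :=
  [/\ forall j, in_L2 (cphi j),
      forall j l, L2_inner (cphi j) (cphi l) = (j == l)%:R &
      forall x, in_L2 x -> L2_limit
        (fun N p => \sum_(0 <= j < N) fourier_coef x j * cphi j p) x].

Definition sobolev (s : R) x : Prop :=
  in_L2 x /\
  (\sum_(1 <= j <oo) (normc (fourier_coef x j) ^+ 2 * ev j `^ (2 * s))%:E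
     < +oo)%E.

Definition sobolev0 (s : R) x : Prop := sobolev s x /\ fourier_coef x 0 = 0.

(* The sum of the series in L2, up to equality almost everywhere: a chosen
   representative (and 0 if the series does not converge). *)
Definition laplace_pow (s : R) x : T -> R[i] :=
  xget (fun=> 0) [set y | in_L2 y /\ L2_limit
    (fun N p => \sum_(1 <= j < N)
       fourier_coef x j * (ev j `^ (2 * s))%:C * cphi j p) y].

End L2.

(* ev j is mu_j, so that the eigenvalues of the Laplacian are the ev j ^+ 2. *)
Record laplace_spectrum (R : realType) (d : nat) (M : riemannian_manifold R d)
    (mu : {measure set (borel M) -> \bar R})
    (ev : nat -> R) (phi : nat -> borel M -> R) : Prop := LaplaceSpectrum {
  ev_0 : ev 0 = 0 ;
  ev_1 : 0 < ev 1 ;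
  ev_incr : forall j, (0 < j)%N -> ev j <= ev j.+1 ;
  phi_smooth : forall j, smooth_fun (phi j) ;
  phi_eigen : forall j, is_laplacian (phi j) (fun p => ev j ^+ 2 * phi j p) ;
  phi_basis : orthonormal_basis mu phi
}.

(* Main.v *)
Require Import Defs.
From mathcomp Require Import all_boot all_order all_algebra complex.
From mathcomp Require Import all_classical all_reals all_analysis.
From mathcomp Require Import measurable_realfun ring lra.

Set Implicit Arguments.
Unset Strict Implicit.
Unset Printing Implicit Defensive.

Import Order.TTheory GRing.Theory Num.Theory.
Import numFieldNormedType.Exports.

Local Open Scope classical_set_scope.
Local Open Scope ring_scope.

(* By Parseval, ||Delta^s x||^2 = \sum_j |a_j|^2 mu_j^(4s), so the inequality is
   Hoelder's inequality for m + 1 sums with the weights |a_j|^2. Writing A_i for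
   ||Delta^(r^i) x||^2, it follows termwise from the weighted AM-GM inequality
   applied to the numbers mu_j^(4 r^i) / A_i, i = 0, ..., m. For phi_l each sum
   has a single term, which gives equality and hence sharpness.
   Since laplace_pow is 0 when its series diverges, Parseval needs the series to
   converge, that is, the completeness of L2 (Riesz-Fischer); the sums of
   exponents below r^m are finite because mu_j >= mu_1 > 0. *)

Local Notation normc := ComplexField.Normc.normc.

(** * Completeness of L2 *)

Section RealL2.
Context {R : realType} {disp : measure_display} {T : measurableType disp}.
Variable mu : {measure set T -> \bar R}.

(* Bounding the increments by 2^-k times a common constant avoids Minkowski's
   inequality for infinite sums. *)
Lemma cvgn_of_weighted_increments (v : nat -> R) :
  (\sum_(0 <= k <oo) (4 ^+ k * (v k.+1 - v k) ^+ 2)%:E)%E \is a fin_num ->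
  cvgn v.
Proof.
set h := (X in X \is a fin_num) => hfin.
have t0 k : (0 <= (4 ^+ k * (v k.+1 - v k) ^+ 2)%:E)%E.
  by rewrite lee_fin mulr_ge0 ?sqr_ge0 ?exprn_ge0.
have h0 : 0 <= fine h by rewrite fine_ge0// nneseries_ge0.
have le_h k : (2 ^+ k * `|v k.+1 - v k|) ^+ 2 <= fine h.
  rewrite -lee_fin fineK//.
  apply: (le_trans _ (nneseries_lim_ge k.+1 (fun n _ _ => t0 n))).
  rewrite big_nat_recr//= exprMn -exprM mulnC exprM real_normK ?num_real//.
  rewrite (_ : 2 ^+ 2 = 4 :> R); last by ring.
  by rewrite leeDr// sume_ge0.
(* No single term exceeds the sum [h], so the increments decay like 2^-k and the telescoping series
   converges absolutely. *)
have step k : `|v k.+1 - v k| <= geometric (Num.sqrt (fine h)) 2^-1 k.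
  rewrite /geometric /= exprVn ler_pdivlMr ?exprn_gt0// mulrC.
  by rewrite -ler_sqr ?nnegrE ?mulr_ge0 ?sqrtr_ge0 ?exprn_ge0// sqr_sqrtr.
have cs : cvgn (series (telescope v)).
  apply: normed_cvg; apply: (series_le_cvg _ _ step) => [n|n|].
  - exact: normr_ge0.
  - by rewrite /geometric /= mulr_ge0 ?sqrtr_ge0 ?exprn_ge0.
  - by apply: is_cvg_geometric_series; rewrite ger0_norm; lra.
rewrite (_ : v = (fun n => v 0%N + series (telescope v) n)); last first.
  by apply/funext => n; exact: eq_sum_telescope.
by apply: is_cvgD => //; exact: is_cvg_cst.
Qed.

(** Along a subsequence the squared increments have integral at most 8^-k, still summable after
    weighting by 4^k. Hence the subsequence converges almost everywhere, and Fatou's lemma passes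
    the Cauchy bound on to its limit. *)
Lemma riesz_fischer (u : nat -> T -> R) (N : nat -> nat) :
  (forall n, measurable_fun setT (u n)) ->
  (forall k m n, (N k <= m)%N -> (N k <= n)%N ->
    (\int[mu]_p ((u m p - u n p) ^+ 2)%:E <= ((8 ^+ k)^-1)%:E)%E) ->
  exists2 y : T -> R, measurable_fun setT y &
    forall k n, (N k <= n)%N ->
      (\int[mu]_p ((u n p - y p) ^+ 2)%:E <= ((8 ^+ k)^-1)%:E)%E.
Proof.
move=> mu_ cau.
(* [N] may fail to be monotone; its partial sums are monotone, and [K k] dominates N 0, ..., N k. *)
pose K k := (\sum_(i < k.+1) N i)%N.
have NK i k : (i <= k)%N -> (N i <= K k)%N.
  move=> ik; rewrite /K (bigD1 (Ordinal (ik : (i < k.+1)%N)))//=.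
  exact: leq_addr.
pose v k := u (K k).
have msq m (f : T -> R) : measurable_fun setT f ->
    measurable_fun setT (EFin \o (fun p => (u m p - f p) ^+ 2)).
  move=> mf; apply/measurable_EFinP; apply: measurable_funX.
  exact: measurable_funB.
pose t k p : \bar R := (4 ^+ k * (v k.+1 p - v k p) ^+ 2)%:E.
have t0 k p : (0 <= t k p)%E.
  by rewrite lee_fin mulr_ge0 ?sqr_ge0 ?exprn_ge0.
have mt k : measurable_fun setT (t k).
  apply/measurable_EFinP; apply: measurable_funM => //.
  by apply: measurable_funX; apply: measurable_funB; exact: mu_.
pose H p := (\sum_(0 <= k <oo) t k p)%E.
have mH : measurable_fun setT H.
  by apply: ge0_emeasurable_sum => // k p _ _; exact: t0.
have H0 p : (0 <= H p)%E by apply: nneseries_ge0 => k _ _; exact: t0.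
(* The k-th term contributes at most 4^k / 8^k = 2^-k. *)
have intH : (\int[mu]_p H p <= 2%:E)%E.
  rewrite /H integral_nneseries//.
  apply: (@le_trans _ _ (\sum_(0 <= k <oo) (geometric 1 2^-1 k)%:E)%E).
    apply: lee_nneseries => [k _ _|k _]; first exact: integral_ge0.
    rewrite /t; under eq_integral do rewrite EFinM.
    rewrite ge0_integralZl_EFin ?exprn_ge0//; last 2 first.
      by move=> p _; rewrite lee_fin sqr_ge0.
      exact: (msq _ _ (mu_ (K k))).
    apply: (@le_trans _ _ ((4 ^+ k)%:E * ((8 ^+ k)^-1)%:E)%E).
      by rewrite lee_pmul2l// ?lte_fin ?exprn_gt0//; apply: cau; apply: NK.
    rewrite -EFinM lee_fin /geometric /= mul1r.
    by rewrite -exprVn -exprMn (_ : 4 / 8 = 2^-1 :> R)//; field.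
  apply: lime_le; first by apply: is_cvg_nneseries => k _ _;
    rewrite lee_fin /geometric /= mul1r exprn_ge0// invr_ge0.
  near=> n; rewrite sumEFin lee_fin.
  rewrite -[leLHS]/(series (geometric 1 2^-1) n) geometric_seriesE; last first.
    by rewrite lt_eqF//; lra.
  rewrite /= mul1r ler_pdivrMr; last lra.
  have : 0 <= 2^-1 ^+ n :> R by rewrite exprn_ge0// invr_ge0.
  lra.
have iH : mu.-integrable setT H.
  apply/integrableP; split => //.
  under eq_integral do rewrite gee0_abs//.
  by rewrite (le_lt_trans intH)// ltry.
(* The upper limit is measurable on the whole space, with no exceptional set to remove; [fine] gives
   0 where it is infinite. *)
pose y p := fine (limn_esup (fun k => (v k p)%:E)).
have my : measurable_fun setT y.
  apply: (measurableT_comp (@fine_measurable R setT measurableT)).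
  apply: (@measurable_fun_limn_esup _ _ _ setT (fun k p => (v k p)%:E)) => k.
  by apply/measurable_EFinP; exact: mu_.
have vy p : H p \is a fin_num -> v ^~ p @ \oo --> y p.
  move=> Hp; have c : cvgn (v ^~ p) by exact: cvgn_of_weighted_increments.
  rewrite /y.
  have /cvg_limn_einf_sup[_ ->] :
      (fun k => (v k p)%:E) @ \oo --> (limn (v ^~ p))%:E.
    by apply: cvg_EFin; [exact: nearW | exact: c].
  exact: c.
exists y => // k n kn.
(* Almost everywhere the integrand is the limit of the same expression with [v (i + k)] for [y]. The
   shift by k keeps every index [K (i + k)] at or beyond [N k]. *)
apply: (@le_trans _ _
  (\int[mu]_p limn_einf (fun i => ((u n p - v (i + k)%N p) ^+ 2)%:E))%E).
  apply: ae_ge0_le_integral => //.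
  - by move=> p _; rewrite lee_fin sqr_ge0.
  - exact: msq.
  - move=> p _; rewrite limn_einf_lim; apply: lime_ge.
      exact: is_cvg_einfs.
    apply: nearW => i; apply: le_ereal_inf_tmp => _ [j _ <-].
    by rewrite lee_fin sqr_ge0.
  (* The lower limit is minus the upper limit of the negatives, so measurability of upper limits
     applies. *)
  - rewrite (_ : (fun _ => _) =
      (fun p =>
        - limn_esup (fun i => - ((u n p - v (i + k)%N p) ^+ 2)%:E))%E)//.
    apply: measurableT_comp => //.
    apply: (@measurable_fun_limn_esup _ _ _ setT
      (fun i p => - ((u n p - v (i + k)%N p) ^+ 2)%:E)%E) => i.
    by apply: measurableT_comp => //; exact: (msq _ _ (mu_ (K (i + k)%N))).
  - move: (integrable_ae measurableT iH); apply: filterS => p /(_ I) Hp _.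
    suff /cvg_limn_einf_sup[-> _] :
      (fun i => ((u n p - v (i + k)%N p) ^+ 2)%:E) @ \oo -->
        ((u n p - y p) ^+ 2)%:E by [].
    apply: cvg_EFin; first by near=> i.
    have c : (fun i => u n p - v (i + k)%N p) @ \oo --> u n p - y p.
      apply: cvgB; first exact: cvg_cst.
      by have := vy p Hp; rewrite -(cvg_shiftn k).
    exact: (cvg_comp _ _ c (@exprn_continuous _ 2 _)).
apply: le_trans (fatou _ _ _ _) _ => //.
- by move=> i; exact: (msq _ _ (mu_ (K (i + k)%N))).
- by move=> i p _; rewrite lee_fin sqr_ge0.
rewrite limn_einf_lim; apply: lime_le; first exact: is_cvg_einfs.
apply: nearW => i; apply: (@le_trans _ _
  (\int[mu]_p ((u n p - v (i + k)%N p) ^+ 2)%:E)%E).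
  apply: ge_ereal_inf; eexists; last exact: lexx.
  by exists i => /=.
by apply: cau => //; apply: NK; exact: leq_addl.
Unshelve. all: by end_near.
Qed.

End RealL2.

(** * Real orthonormal sums *)

Section OrthonormalSums.
Context {R : realType} {disp : measure_display} {T : measurableType disp}.
Variable mu : {measure set T -> \bar R}.
Variable phi : nat -> T -> R.
Hypothesis phi_meas : forall j, measurable_fun setT (phi j).
Hypothesis phi_int :
  forall i j, mu.-integrable setT (EFin \o (fun p => phi i p * phi j p)).
Hypothesis phi_orth :
  forall i j, (\int[mu]_p (phi i p * phi j p)%:E = (i == j)%:R%:E)%E.

Lemma measurable_lin_comb (b : nat -> R) (s : seq nat) :
  measurable_fun setT (fun p => \sum_(j <- s) b j * phi j p).
Proof. by apply: measurable_sum => j; exact: measurable_funM. Qed.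

(** Pythagoras: the square expands into a double sum whose off-diagonal terms integrate to 0. *)
Lemma integral_sqr_lin_comb (b : nat -> R) (s : seq nat) : uniq s ->
  (\int[mu]_p ((\sum_(j <- s) b j * phi j p) ^+ 2)%:E =
    (\sum_(j <- s) b j ^+ 2)%:E)%E.
Proof.
move=> us.
pose f i j p : \bar R := ((b i * b j)%:E * (phi i p * phi j p)%:E)%E.
have fi i j : mu.-integrable setT (f i j).
  exact: (integrableZl _ _ (phi_int i j)).
transitivity (\int[mu]_p \sum_(i <- s) \sum_(j <- s) f i j p)%E.
  apply: eq_integral => p _; rewrite expr2 big_distrlr/= -sumEFin.
  apply: eq_bigr => i _; rewrite -sumEFin; apply: eq_bigr => j _.
  by rewrite /f -EFinM; congr (_%:E); ring.
rewrite (integral_sum measurableT); last first.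
  by move=> i; exact: integrable_sum.
rewrite -sumEFin big_seq [RHS]big_seq; apply: eq_bigr => i si.
rewrite (integral_sum measurableT)//.
rewrite (bigD1_seq i)//= big1 ?adde0.
  by rewrite (integralZl measurableT (phi_int i i)) phi_orth eqxx mule1.
move=> j ji; rewrite (integralZl measurableT (phi_int i j)) phi_orth.
by rewrite eq_sym (negbTE ji) mule0.
Qed.

Lemma orthonormal_series_cauchy (b : nat -> R) (w : nat -> R) (m n : nat) :
  (forall j, b j ^+ 2 <= w j) -> (0 < m)%N -> (m <= n)%N ->
  (\int[mu]_p ((\sum_(1 <= j < n) b j * phi j p -
      \sum_(1 <= j < m) b j * phi j p) ^+ 2)%:E <=
    (\sum_(1 <= j < n) w j - \sum_(1 <= j < m) w j)%:E)%E.
Proof.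
move=> bw m0 mn.
have split (F : nat -> R) : \sum_(1 <= j < n) F j -
    \sum_(1 <= j < m) F j = \sum_(m <= j < n) F j.
  by rewrite (big_cat_nat (n := m) (p := n))//= addrAC subrr add0r.
rewrite split; under eq_integral do rewrite split.
rewrite integral_sqr_lin_comb ?iota_uniq// lee_fin.
by apply: ler_sum.
Qed.

(** The rate is that of a majorant [w] of the squared coefficients, so that the real and imaginary
    parts of a complex series can share one [N]. *)
Lemma orthonormal_series_cvg (b : nat -> R) (w : nat -> R) (N : nat -> nat) :
  (forall j, b j ^+ 2 <= w j) -> (forall k, (0 < N k)%N) ->
  (forall k m n, (N k <= m)%N -> (N k <= n)%N ->
    \sum_(1 <= j < m) w j - \sum_(1 <= j < n) w j <= (8 ^+ k)^-1) ->
  exists2 y : T -> R, measurable_fun setT y & forall k n, (N k <= n)%N ->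
    (\int[mu]_p ((\sum_(1 <= j < n) b j * phi j p - y p) ^+ 2)%:E <=
      ((8 ^+ k)^-1)%:E)%E.
Proof.
move=> bw N0 wN; apply: riesz_fischer => [n|k m n].
  exact: measurable_lin_comb.
wlog mn : m n / (n <= m)%N => [hwlog km kn|km kn].
  have [/hwlog|/ltnW /hwlog] := leqP n m; first exact.
  move=> /(_ kn km); congr (_ <= _)%E.
  by apply: eq_integral => p _; rewrite -sqrrN opprB.
apply: le_trans (orthonormal_series_cauchy bw _ mn) _.
  exact: leq_trans (N0 k) kn.
by rewrite lee_fin wN.
Qed.

End OrthonormalSums.

(** * Norms of complex-valued functions *)

Section ComplexL2.
Local Open Scope complex_scope.
Context {R : realType} {disp : measure_display} {T : measurableType disp}.
Variable mu : {measure set T -> \bar R}.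
Implicit Types x y : T -> R[i].

Lemma sqr_normcE (z : R[i]) :
  normc z ^+ 2 = complex.Re z ^+ 2 + complex.Im z ^+ 2.
Proof. by case: z => a b; rewrite /= sqr_sqrtr// addr_ge0// sqr_ge0. Qed.

Lemma normc_ge0 (z : R[i]) : 0 <= normc z.
Proof. by case: z => a b; exact: sqrtr_ge0. Qed.

Lemma normc_real (a : R) : normc a%:C = `|a|.
Proof. by rewrite /normc /= expr0n addr0 sqrtr_sqr. Qed.

Lemma ReB (z w : R[i]) : complex.Re (z - w) = complex.Re z - complex.Re w.
Proof. by case: z w => [a b] [c e]. Qed.

Lemma ImB (z w : R[i]) : complex.Im (z - w) = complex.Im z - complex.Im w.
Proof. by case: z w => [a b] [c e]. Qed.

Definition measurable_cfun x :=
  measurable_fun setT (fun p => complex.Re (x p)) /\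
  measurable_fun setT (fun p => complex.Im (x p)).

Lemma measurable_normc x : measurable_cfun x ->
  measurable_fun setT (fun p => normc (x p)).
Proof.
case=> mre mim.
rewrite (_ : (fun _ => _) = (fun p => Num.sqrt
    (complex.Re (x p) ^+ 2 + complex.Im (x p) ^+ 2))); last first.
  by apply/funext => p; case: (x p).
apply: measurableT_comp.
  by apply: continuous_measurable_fun; exact: sqrt_continuous.
by apply: measurable_funD; exact: measurable_funX.
Qed.

Lemma measurable_sqr_normc x : measurable_cfun x ->
  measurable_fun setT (fun p => (normc (x p) ^+ 2)%:E).
Proof.
by move=> mx; apply/measurable_EFinP/measurable_funX; exact: measurable_normc.
Qed.

Lemma measurable_cfunB x y : measurable_cfun x -> measurable_cfun y ->
  measurable_cfun (fun p => x p - y p).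
Proof.
move=> [rx ix] [ry iy]; split.
- by under eq_fun do rewrite ReB; exact: measurable_funB.
- by under eq_fun do rewrite ImB; exact: measurable_funB.
Qed.

Lemma L2_enormE x :
  L2_enorm mu x = ((\int[mu]_p (normc (x p) ^+ 2)%:E) `^ 2^-1)%E.
Proof.
rewrite /L2_enorm unlock; congr (_ `^ _)%E; apply: eq_integral => p _.
by rewrite gee0_abs ?lee_fin ?normc_ge0// poweR_EFin powR_mulrn ?normc_ge0.
Qed.

Lemma L2_norm_ge0 x : 0 <= L2_norm mu x.
Proof. by rewrite /L2_norm fine_ge0// Lnorm_ge0. Qed.

(** When the integral is infinite both sides are 0, since [fine] sends infinity to 0. *)
Lemma L2_norm_sqr x :
  L2_norm mu x ^+ 2 = fine (\int[mu]_p (normc (x p) ^+ 2)%:E).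
Proof.
rewrite /L2_norm L2_enormE.
have : (0 <= \int[mu]_p (normc (x p) ^+ 2)%:E)%E.
  by apply: integral_ge0 => p _; rewrite lee_fin sqr_ge0.
case: (\int[mu]_p _)%E => [r|_|//].
- by rewrite lee_fin => r0; rewrite poweR_EFin /= powR12_sqrt// sqr_sqrtr.
- by rewrite poweRyr ?invr_eq0// expr0n.
Qed.

Lemma L2_enorm_lty x :
  (L2_enorm mu x < +oo)%E <-> (\int[mu]_p (normc (x p) ^+ 2)%:E < +oo)%E.
Proof.
rewrite L2_enormE; split; last exact: poweR_lty.
apply: contraPT; rewrite -leNgt leye_eq => /eqP ->.
by rewrite poweRyr ?invr_eq0.
Qed.

(** Minkowski's inequality for the real functions |x| and |y|, combined with |x - y| <= |x| + |y|
    pointwise. *)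
Lemma L2_enormB x y : measurable_cfun x -> measurable_cfun y ->
  (L2_enorm mu (fun p => x p - y p)%R <= L2_enorm mu x + L2_enorm mu y)%E.
Proof.
move=> mx my.
have [mnx mny] := (measurable_normc mx, measurable_normc my).
have mxy := measurable_cfunB mx my.
apply: le_trans (minkowski_EFin mu mnx mny _); last by rewrite ler1n.
rewrite L2_enormE unlock.
have sumE p : (`|(EFin \o ((fun p => normc (x p)) \+
    (fun p => normc (y p)))%R) p| `^ 2 =
    ((normc (x p) + normc (y p)) ^+ 2)%:E)%E.
  rewrite /= ger0_norm ?addr_ge0 ?normc_ge0//.
  by rewrite powR_mulrn ?addr_ge0 ?normc_ge0.
under [in leRHS]eq_integral do rewrite sumE.
have i0 (f : T -> R) : (\int[mu]_p ((f p) ^+ 2)%:E)%E \in `[0%E, +oo%E].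
  rewrite in_itv /= leey andbT integral_ge0// => p _.
  by rewrite lee_fin sqr_ge0.
apply: gt0_ler_poweR => //.
apply: ge0_le_integral => //.
- by move=> p _; rewrite lee_fin sqr_ge0.
- exact: measurable_sqr_normc.
- by apply/measurable_EFinP/measurable_funX; exact: measurable_funD.
- move=> p _; rewrite lee_fin ler_sqr ?nnegrE ?addr_ge0 ?normc_ge0//.
  by rewrite (le_trans (le_normcD _ _))// normcN.
Qed.

Lemma in_L2_measurable x : in_L2 mu x -> measurable_cfun x.
Proof. by case. Qed.

Lemma in_L2B x y : in_L2 mu x -> in_L2 mu y -> in_L2 mu (fun p => x p - y p).
Proof.
move=> x2 y2; have [mx my] := (in_L2_measurable x2, in_L2_measurable y2).
have [mre mim] := measurable_cfunB mx my; split => //.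
by apply: le_lt_trans (L2_enormB mx my) _; case: x2 y2 => _ _ ? [_ _ ?];
  exact: lte_add_pinfty.
Qed.

Lemma L2_norm_fineK x : in_L2 mu x -> (L2_norm mu x)%:E = L2_enorm mu x.
Proof. by case=> _ _ xoo; rewrite /L2_norm fineK// ge0_fin_numE ?Lnorm_ge0. Qed.

Lemma L2_normB x y : in_L2 mu x -> in_L2 mu y ->
  L2_norm mu (fun p => x p - y p) <= L2_norm mu x + L2_norm mu y.
Proof.
move=> x2 y2; rewrite -lee_fin EFinD !L2_norm_fineK//; last exact: in_L2B.
by apply: L2_enormB; exact: in_L2_measurable.
Qed.

Lemma L2_normC x y : L2_norm mu (fun p => x p - y p) =
  L2_norm mu (fun p => y p - x p).
Proof.
rewrite /L2_norm /L2_enorm; congr (fine (Lnorm _ _ _)); apply/funext => p.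
by rewrite -opprB normcN.
Qed.

Lemma ler_dist_L2_norm x y : in_L2 mu x -> in_L2 mu y ->
  `|L2_norm mu x - L2_norm mu y| <= L2_norm mu (fun p => x p - y p).
Proof.
have main u v : in_L2 mu u -> in_L2 mu v ->
    L2_norm mu u - L2_norm mu v <= L2_norm mu (fun p => u p - v p).
  (* The triangle inequality is applied to u = v - (v - u). *)
  move=> u2 v2; have := L2_normB v2 (in_L2B v2 u2).
  rewrite (_ : (fun p => v p - (v p - u p)) = u).
    by rewrite lerBlDl L2_normC.
  by apply/funext => p; rewrite subKr.
move=> x2 y2; rewrite ler_norml main// andbT lerNl opprB L2_normC.
exact: main.
Qed.

Lemma L2_limit_norm (u : nat -> T -> R[i]) y : (forall n, in_L2 mu (u n)) ->
  in_L2 mu y -> L2_limit mu u y ->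
  (fun n => L2_norm mu (u n)) @ \oo --> L2_norm mu y.
Proof.
move=> u2 y2 uy; apply/cvgrPdist_le => e e0.
move/cvgr0Pnorm_le : uy => /(_ e e0); apply: filterS => n.
rewrite ger0_norm ?L2_norm_ge0// => le_e.
by apply: le_trans le_e; rewrite distrC; exact: ler_dist_L2_norm.
Qed.

End ComplexL2.

(** * Orthonormal series *)

Section OrthonormalSeries.
Local Open Scope complex_scope.
Context {R : realType} {disp : measure_display} {T : measurableType disp}.
Variable mu : {measure set T -> \bar R}.
Variable phi : nat -> T -> R.
Hypothesis phi_basis : orthonormal_basis mu phi.
Implicit Types c : nat -> R[i].

Let phi_meas j : measurable_fun setT (phi j).
Proof. by case: phi_basis => /(_ j)[]. Qed.

Let phi_int i j : mu.-integrable setT (EFin \o (fun p => phi i p * phi j p)).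
Proof.
have sqr_int l : mu.-integrable setT (EFin \o (fun p => phi l p ^+ 2)).
  apply/integrableP; split; first exact/measurable_EFinP/measurable_funX.
  have [/(_ l)[_ _ /L2_enorm_lty +] _ _] := phi_basis.
  congr (_ < _)%E; apply: eq_integral => p _.
  by rewrite normc_real real_normK ?num_real//= ger0_norm ?sqr_ge0.
apply: le_integrable (integrableD measurableT (sqr_int i) (sqr_int j)) => //.
  by apply/measurable_EFinP/measurable_funM.
move=> p _ /=; rewrite lee_fin [leRHS]ger0_norm ?addr_ge0 ?sqr_ge0// normrM.
rewrite -(real_normK (num_real (phi i p))) -(real_normK (num_real (phi j p))).
(* From (|a| - |b|)^2 >= 0 and |a| |b| >= 0 follows |a b| <= a^2 + b^2, an integrable bound. *)
have := sqr_ge0 (`|phi i p| - `|phi j p|).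
have := mulr_ge0 (normr_ge0 (phi i p)) (normr_ge0 (phi j p)).
nra.
Qed.

Let phi_orth i j : (\int[mu]_p (phi i p * phi j p)%:E = (i == j)%:R%:E)%E.
Proof.
rewrite -(fineK (integrable_fin_num measurableT (phi_int i j))); congr _%:E.
have [_ /(_ i j) + _] := phi_basis => /(congr1 (@complex.Re R)).
rewrite /L2_inner /= /Rintegral => E.
transitivity (complex.Re ((i == j)%:R : R[i])); last by case: (i == j).
rewrite -{}E; congr fine; apply: eq_integral => p _.
by rewrite /= oppr0 mulr0 subr0.
Qed.

(** The index starts at 1, as in [laplace_pow]: the eigenvalue 0 is left out. *)
Definition partial_sum c n : T -> R[i] :=
  fun p => \sum_(1 <= j < n) c j * cphi phi j p.

Lemma Re_partial_sum c n p : complex.Re (partial_sum c n p) =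
  \sum_(1 <= j < n) complex.Re (c j) * phi j p.
Proof.
rewrite (big_morph (@complex.Re R) (id1 := 0) (op1 := +%R))//; last first.
  by move=> [? ?] [].
by apply: eq_bigr => j _; case: (c j) => a b /=; rewrite mulr0 subr0.
Qed.

Lemma Im_partial_sum c n p : complex.Im (partial_sum c n p) =
  \sum_(1 <= j < n) complex.Im (c j) * phi j p.
Proof.
rewrite (big_morph (@complex.Im R) (id1 := 0) (op1 := +%R))//; last first.
  by move=> [? ?] [].
by apply: eq_bigr => j _; case: (c j) => a b /=; rewrite mulr0 add0r.
Qed.

Lemma measurable_partial_sum c n : measurable_cfun (partial_sum c n).
Proof.
split.
- under eq_fun do rewrite Re_partial_sum; exact: measurable_lin_comb.
- under eq_fun do rewrite Im_partial_sum; exact: measurable_lin_comb.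
Qed.

Lemma integral_sqr_normc (x : T -> R[i]) : measurable_cfun x ->
  (\int[mu]_p (normc (x p) ^+ 2)%:E =
    \int[mu]_p (complex.Re (x p) ^+ 2)%:E +
    \int[mu]_p (complex.Im (x p) ^+ 2)%:E)%E.
Proof.
move=> [mre mim]; rewrite -ge0_integralD//.
- by apply: eq_integral => p _; rewrite sqr_normcE.
- by move=> p _; rewrite lee_fin sqr_ge0.
- exact/measurable_EFinP/measurable_funX.
- by move=> p _; rewrite lee_fin sqr_ge0.
- exact/measurable_EFinP/measurable_funX.
Qed.

Lemma integral_partial_sum c n :
  (\int[mu]_p (normc (partial_sum c n p) ^+ 2)%:E =
    (\sum_(1 <= j < n) normc (c j) ^+ 2)%:E)%E.
Proof.
rewrite integral_sqr_normc; last exact: measurable_partial_sum.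
under eq_integral do rewrite Re_partial_sum.
under [X in (_ + X)%E]eq_integral do rewrite Im_partial_sum.
rewrite !(integral_sqr_lin_comb phi_int phi_orth) ?iota_uniq//.
rewrite -EFinD -big_split; congr _%:E.
by apply: eq_bigr => j _; rewrite /= sqr_normcE.
Qed.

Lemma in_L2_partial_sum c n : in_L2 mu (partial_sum c n).
Proof.
have [mre mim] := measurable_partial_sum c n; split=> //.
by apply/L2_enorm_lty; rewrite integral_partial_sum ltry.
Qed.

Lemma L2_norm_partial_sum c n :
  L2_norm mu (partial_sum c n) ^+ 2 = \sum_(1 <= j < n) normc (c j) ^+ 2.
Proof. by rewrite L2_norm_sqr integral_partial_sum. Qed.

(** Parseval: the norm is continuous along L2 limits, and Pythagoras gives the norms of the partial
    sums. *)
Lemma L2_norm_series c y : in_L2 mu y -> L2_limit mu (partial_sum c) y ->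
  (fun n => \sum_(1 <= j < n) normc (c j) ^+ 2) @ \oo --> L2_norm mu y ^+ 2.
Proof.
move=> y2 cy.
rewrite (_ : (fun n => _) = (fun n => L2_norm mu (partial_sum c n) ^+ 2)).
  have h := L2_limit_norm (in_L2_partial_sum c) y2 cy.
  exact: (cvg_comp _ _ h (@exprn_continuous _ 2 _)).
by apply/funext => n; rewrite L2_norm_partial_sum.
Qed.

(** Supplies the rate 8^-k on which [riesz_fischer] relies: bounded sums of nonnegative terms
    converge, hence are Cauchy. *)
Lemma geometric_cauchy_rate (w : nat -> R) (B : R) : (forall j, 0 <= w j) ->
  (forall n, \sum_(1 <= j < n) w j <= B) ->
  exists N : nat -> nat, (forall k, (0 < N k)%N) /\
    forall k m n, (N k <= m)%N -> (N k <= n)%N ->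
      \sum_(1 <= j < m) w j - \sum_(1 <= j < n) w j <= (8 ^+ k)^-1.
Proof.
move=> w0 wB; pose P n := \sum_(1 <= j < n) w j.
have /cvg_ex[l Pl] : cvgn P.
  apply: nondecreasing_is_cvgn.
    move=> m [|n] mn; first by move: mn; rewrite leqn0 => /eqP ->.
    case: m mn => [|m] mn; first by rewrite {1}/P big_geq// sumr_ge0.
    by rewrite /P (big_cat_nat (n := m.+1) (p := n.+1))//= lerDl sumr_ge0.
  by exists B => _ [n _ <-]; exact: wB.
have N_ex k : exists N, forall n, (N <= n)%N -> `|l - P n| <= (8 ^+ k)^-1 / 2.
  have e0 : 0 < (8 ^+ k)^-1 / 2 :> R by rewrite divr_gt0 ?invr_gt0 ?exprn_gt0.
  by move/cvgrPdist_le : Pl => /(_ _ e0)[N _ NP]; exists N.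
have [N NP] := choice N_ex.
(* The successor makes the index positive, as splitting a sum that starts at 1 requires. Two errors
   of size 8^-k / 2 add up to the bound. *)
exists (fun k => (N k).+1); split=> // k m n /ltnW/NP + /ltnW/NP.
rewrite -/(P m) -/(P n) !ler_norml => /andP[? ?] /andP[? ?]; lra.
Qed.

(** Real and imaginary parts converge separately, both at the rate of the sums of
    [normc (c j) ^+ 2]. *)
Lemma orthonormal_series_L2 c (B : R) :
  (forall n, \sum_(1 <= j < n) normc (c j) ^+ 2 <= B) ->
  exists y, in_L2 mu y /\ L2_limit mu (partial_sum c) y.
Proof.
move=> cB; have [N [N0 NP]] := geometric_cauchy_rate (fun j => sqr_ge0 _) cB.
have re_le j : complex.Re (c j) ^+ 2 <= normc (c j) ^+ 2.
  by rewrite sqr_normcE lerDl sqr_ge0.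
have im_le j : complex.Im (c j) ^+ 2 <= normc (c j) ^+ 2.
  by rewrite sqr_normcE lerDr sqr_ge0.
have [y1 my1 y1P] :=
  orthonormal_series_cvg phi_meas phi_int phi_orth re_le N0 NP.
have [y2 my2 y2P] :=
  orthonormal_series_cvg phi_meas phi_int phi_orth im_le N0 NP.
pose y p := y1 p +i* y2 p.
have my : measurable_cfun y by split.
have dist k n : (N k <= n)%N ->
    (\int[mu]_p (normc (partial_sum c n p - y p) ^+ 2)%:E <=
      (2 * (8 ^+ k)^-1)%:E)%E.
  move=> kn; rewrite integral_sqr_normc; last first.
    by apply: measurable_cfunB => //; exact: measurable_partial_sum.
  rewrite mulr_natl mulr2n EFinD; apply: leeD.
    by under eq_integral do rewrite ReB Re_partial_sum; exact: y1P.
  by under eq_integral do rewrite ImB Im_partial_sum; exact: y2P.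
exists y; split.
  (* [y] is a partial sum minus its error, and both are in L2. *)
  have d2 : in_L2 mu (fun p => partial_sum c (N 0%N) p - y p).
    have [mre mim] := measurable_cfunB (measurable_partial_sum c (N 0%N)) my.
    split=> //; apply/L2_enorm_lty.
    exact: le_lt_trans (dist 0%N _ (leqnn _)) (ltry _).
  have := in_L2B (in_L2_partial_sum c (N 0%N)) d2.
  by under eq_fun do rewrite subKr.
apply/cvgr0Pnorm_le => e e0.
(* [dist] bounds the square of the norm, hence the comparison with e^2. *)
have [k ke] : exists k, 2 * (8 ^+ k)^-1 <= e ^+ 2.
  have := @cvg_geometric R 2 8^-1.
  rewrite ger0_norm ?invr_ge0// => /(_ _)/cvgr0Pnorm_le.
  have -> : 8^-1 < 1 :> R by lra.
  move=> /(_ isT _ (exprn_gt0 2 e0))[k _ /(_ k (leqnn k))].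
  rewrite /geometric /= exprVn ger0_norm ?mulr_ge0 ?invr_ge0 ?exprn_ge0//.
  by exists k.
exists (N k) => // n kn /=.
rewrite ger0_norm ?L2_norm_ge0// -ler_sqr ?nnegrE ?L2_norm_ge0 ?(ltW e0)//.
apply: le_trans ke; rewrite L2_norm_sqr -lee_fin fineK; first exact: dist.
rewrite ge0_fin_numE; first exact: le_lt_trans (dist k n kn) (ltry _).
by apply: integral_ge0 => p _; rewrite lee_fin sqr_ge0.
Qed.

End OrthonormalSeries.

(** * Hoelder inequality for several sums *)

Section WeightedHoelder.
Context {R : realType} {I : finType}.
Implicit Types (lam r z A : I -> R).

Lemma prod_powR (a : R) (f : I -> R) : 0 < a ->
  \prod_i a `^ f i = a `^ (\sum_i f i).
Proof.
move=> a0; apply/esym/(big_morph (fun s => a `^ s)) => [s t|].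
- by rewrite powRD// (gt_eqF a0) implybT.
- exact: powRr0.
Qed.

(** With M the weighted mean, 1 + u <= exp u gives z_i <= M exp (z_i / M - 1). Raising to the powers
    lam_i and multiplying, the exponents add up to M / M - 1 = 0. *)
Lemma weighted_AMGM lam z : (forall i, 0 <= lam i) -> \sum_i lam i = 1 ->
  (forall i, 0 < z i) -> \prod_i z i `^ lam i <= \sum_i lam i * z i.
Proof.
move=> lam0 lam1 z0; set M := \sum_i _.
have M0 : 0 < M.
  rewrite lt_neqAle sumr_ge0 ?andbT => [|i _]; last by rewrite mulr_ge0// ltW.
  apply/eqP => /esym M0; have : \sum_i lam i = 0; last by rewrite lam1; lra.
  apply: big1 => i _; move/psumr_eq0P : M0 => /(_ _ i isT).
  move=> /(_ (fun i _ => mulr_ge0 (lam0 i) (ltW (z0 i))))/eqP.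
  by rewrite mulf_eq0 [z i == 0]gt_eqF// orbF => /eqP.
have zM i : z i `^ lam i <= M `^ lam i * expR (lam i * (z i / M - 1)).
  rewrite [lam i * _]mulrC expRM -powRM ?expR_ge0 ?(ltW M0)//.
  apply: ge0_ler_powR;
    rewrite ?nnegrE ?mulr_ge0 ?expR_ge0 ?(ltW M0) ?(ltW (z0 i))//.
  by rewrite mulrC -ler_pdivrMr// (le_trans _ (expR_ge1Dx _))// addrC subrK.
have le_prod : \prod_i z i `^ lam i <=
    \prod_i (M `^ lam i * expR (lam i * (z i / M - 1))).
  by apply: ler_prod => i _; rewrite powR_ge0 zM.
apply: le_trans le_prod _.
rewrite big_split/= prod_powR// lam1 powRr1 ?(ltW M0)// -expR_sum.
under eq_bigr do rewrite mulrBr mulr1 mulrA.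
by rewrite sumrB -mulr_suml lam1 -/M divff ?gt_eqF// subrr expR0 mulr1.
Qed.

(** The [A i] are positive upper bounds rather than the sums themselves, so that finite partial sums
    can be compared directly with full squared norms. *)
Lemma weighted_hoelder_sum lam r A (w t : nat -> R) (s : seq nat) :
  (forall i, 0 <= lam i) -> \sum_i lam i = 1 -> (forall i, 0 < A i) ->
  (forall j, 0 <= w j) -> (forall j, j \in s -> 0 < t j) ->
  (forall i, \sum_(j <- s) w j * t j `^ r i <= A i) ->
  \sum_(j <- s) w j * t j `^ (\sum_i lam i * r i) <= \prod_i A i `^ lam i.
Proof.
move=> lam0 lam1 A0 w0 t0 wA; set P := \prod_i _.
have P0 : 0 <= P by apply: prodr_ge0 => i _; exact: powR_ge0.
have term j : j \in s -> w j * t j `^ (\sum_i lam i * r i) <=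
    P * \sum_i lam i / A i * (w j * t j `^ r i).
  move=> /t0 tj; rewrite -prod_powR//.
  (* Dividing by [A i] normalises the i-th family: its sum over j with weights [w j] is at most
     1. *)
  pose z i := t j `^ r i / A i.
  have -> : \prod_i t j `^ (lam i * r i) = P * \prod_i z i `^ lam i.
    rewrite -big_split; apply: eq_bigr => i _ /=.
    rewrite -powRM ?divr_ge0 ?powR_ge0 ?(ltW (A0 i))// /z [A i * _]mulrC.
    by rewrite divfK ?gt_eqF// -powRrM [r i * _]mulrC.
  rewrite mulrCA ler_wpM2l//.
  have z0 i : 0 < z i by rewrite divr_gt0 ?powR_gt0.
  apply: le_trans (ler_wpM2l (w0 j) (weighted_AMGM lam0 lam1 z0)) _.
  rewrite mulr_sumr le_eqVlt; apply/orP; left; apply/eqP.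
  by apply: eq_bigr => i _; rewrite /z; ring.
(* After exchanging the sums, the i-th inner sum is at most [A i], so the factor of [P] is at most
   the sum of the [lam i], which is 1. *)
rewrite big_seq; apply: le_trans (ler_sum _ term) _.
rewrite -big_seq -mulr_sumr exchange_big/= -[leRHS]mulr1 ler_wpM2l// -lam1.
apply: ler_sum => i _; rewrite -mulr_sumr mulrAC ler_pdivrMr//.
exact: ler_wpM2l.
Qed.

End WeightedHoelder.

(** * Powers of the Laplacian *)

Section LaplacePowers.
Local Open Scope complex_scope.
Context {R : realType} {disp : measure_display} {T : measurableType disp}.
Variable mu : {measure set T -> \bar R}.
Variables (ev : nat -> R) (phi : nat -> T -> R).
Hypothesis phi_basis : orthonormal_basis mu phi.
Hypothesis ev_1 : 0 < ev 1%N.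
Hypothesis ev_incr : forall j, (0 < j)%N -> ev j <= ev j.+1.
Implicit Types (x : T -> R[i]) (s : R).

(** Partial sums of ||Delta^s x||^2; the exponent 4s is written as in [sobolev] of order 2s. *)
Definition spectral_sum x s n : R :=
  \sum_(1 <= j < n)
    normc (fourier_coef mu phi x j) ^+ 2 * ev j `^ (2 * (2 * s)).

Lemma ev_ge_ev1 j : (0 < j)%N -> ev 1%N <= ev j.
Proof.
elim: j => // -[_ //|j IH] _.
exact: le_trans (IH isT) (ev_incr _).
Qed.

Lemma ev_gt0 j : (0 < j)%N -> 0 < ev j.
Proof. by move=> /ev_ge_ev1; exact: lt_le_trans. Qed.

(** As 4 (s' - s) <= 0 and mu_j >= mu_1 > 0, the factor mu_j^(4 (s' - s)) is at most its value at j
    = 1. *)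
Lemma spectral_sum_ub x s s' : s' <= s -> sobolev mu ev phi (2 * s) x ->
  exists B, forall n, spectral_sum x s' n <= B.
Proof.
move=> ss' [_ xoo].
pose t j : R := normc (fourier_coef mu phi x j) ^+ 2 * ev j `^ (2 * (2 * s)).
have t0 j : 0 <= t j by rewrite mulr_ge0 ?sqr_ge0 ?powR_ge0.
exists (ev 1%N `^ (2 * (2 * (s' - s))) * fine (\sum_(1 <= j <oo) (t j)%:E)%E).
move=> n; apply: (@le_trans _ _
  (ev 1%N `^ (2 * (2 * (s' - s))) * \sum_(1 <= j < n) t j)).
  rewrite mulr_sumr; apply: ler_sum_nat => j /andP[j1 _].
  rewrite /t [leRHS]mulrCA ler_wpM2l ?sqr_ge0//.
  rewrite (_ : 2 * (2 * s') = 2 * (2 * (s' - s)) + 2 * (2 * s)); last by ring.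
  rewrite powRD ?(gt_eqF (ev_gt0 j1)) ?implybT// ler_wpM2r ?powR_ge0//.
  rewrite (_ : 2 * (2 * (s' - s)) = - (2 * (2 * (s - s')))); last by ring.
  rewrite !powRN lef_pV2 ?posrE ?powR_gt0 ?ev_gt0//.
  apply: ge0_ler_powR; rewrite ?nnegrE ?(ltW (ev_gt0 _))// ?ev_ge_ev1//.
  by rewrite !mulr_ge0// subr_ge0.
rewrite ler_wpM2l ?powR_ge0// -lee_fin fineK.
  rewrite -sumEFin; apply: nneseries_lim_ge => j _ _.
  by rewrite lee_fin t0.
by rewrite ge0_fin_numE// nneseries_ge0// => j _ _; rewrite lee_fin t0.
Qed.

(** The bound makes the series converge, so the chosen value is a genuine L2 limit and not the
    default 0; Parseval then applies to it. *)
Lemma laplace_pow_norm x s (B : R) : (forall n, spectral_sum x s n <= B) ->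
  spectral_sum x s @ \oo --> L2_norm mu (laplace_pow mu ev phi s x) ^+ 2.
Proof.
pose c j : R[i] := fourier_coef mu phi x j * (ev j `^ (2 * s))%:C.
have cE : spectral_sum x s = (fun n => \sum_(1 <= j < n) normc (c j) ^+ 2).
  apply/funext => n; apply: eq_bigr => j _.
  rewrite /c ComplexField.Normc.normcM exprMn normc_real real_normK ?num_real//.
  by congr (_ * _); rewrite -powR_mulrn ?powR_ge0// -powRrM mulrC.
rewrite cE => cB.
have /(xgetPex (fun=> 0))[y2 cy] := orthonormal_series_L2 phi_basis cB.
exact: (L2_norm_series phi_basis y2 cy).
Qed.

Lemma spectral_sum_le_norm x s (B : R) n :
  (forall n, spectral_sum x s n <= B) ->
  spectral_sum x s n <= L2_norm mu (laplace_pow mu ev phi s x) ^+ 2.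
Proof.
move=> xB; have xs := laplace_pow_norm xB.
rewrite -(cvg_lim (@Rhausdorff _) xs).
apply: nondecreasing_cvgn_le; last by apply/cvg_ex; eexists; exact: xs.
move=> m k mk; rewrite /spectral_sum.
(* The sums start at 1, so cutting at [m] needs m > 0; for m = 0 the smaller sum is empty. *)
have [m0|m0] := posnP m.
  rewrite m0 big_geq// sumr_ge0// => j _.
  by rewrite mulr_ge0 ?sqr_ge0 ?powR_ge0.
rewrite (big_cat_nat (n := m) (p := k))//= lerDl sumr_ge0// => j _.
by rewrite mulr_ge0 ?sqr_ge0 ?powR_ge0.
Qed.

Lemma fourier_coef_cphi l j : fourier_coef mu phi (cphi phi l) j = (l == j)%:R.
Proof. by case: phi_basis => _ orth _; exact: orth. Qed.

Lemma spectral_sum_cphi l s n : (0 < l)%N ->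
  spectral_sum (cphi phi l) s n =
    if (l < n)%N then ev l `^ (2 * (2 * s)) else 0.
Proof.
move=> l0; rewrite /spectral_sum.
under eq_bigr do rewrite fourier_coef_cphi.
have normc_bool (b : bool) : normc (b%:R : R[i]) ^+ 2 = b%:R :> R.
  by rewrite sqr_normcE; case: b => /=; rewrite ?expr1n expr0n addr0.
case: ifPn => ln.
  rewrite (bigD1_seq l) ?iota_uniq ?mem_index_iota ?l0//= eqxx normc_bool mul1r.
  rewrite big1 ?addr0// => j jl.
  by rewrite eq_sym (negbTE jl) normc_bool mul0r.
rewrite big_nat_cond big1// => j /andP[/andP[_ jn] _].
rewrite (_ : l == j = false) ?normc_bool ?mul0r//.
by apply: contraNF ln => /eqP ->.
Qed.

Lemma spectral_sum_cphi_ub l s n : (0 < l)%N ->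
  spectral_sum (cphi phi l) s n <= ev l `^ (2 * (2 * s)).
Proof.
by move=> l0; rewrite spectral_sum_cphi//; case: ifP; rewrite ?powR_ge0.
Qed.

(** The spectral sums are constant from n = l + 1 on, and uniqueness of their limit gives the norm
    without identifying the chosen representative. *)
Lemma laplace_pow_cphi l s : (0 < l)%N ->
  L2_norm mu (laplace_pow mu ev phi s (cphi phi l)) = ev l `^ (2 * s).
Proof.
move=> l0; apply/eqP; rewrite -(@eqrXn2 _ 2) ?L2_norm_ge0 ?powR_ge0//.
apply/eqP.
have lim1 := laplace_pow_norm (fun n => spectral_sum_cphi_ub s n l0).
rewrite -[RHS]powR_mulrn ?powR_ge0// -powRrM [X in _ `^ X]mulrC.
have lim2 : spectral_sum (cphi phi l) s @ \oo --> ev l `^ (2 * (2 * s)).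
  apply: cvg_near_cst; exists l.+1 => // n /= ln.
  by rewrite spectral_sum_cphi// ln.
exact: (cvg_unique (@Rhausdorff R) lim1 lim2).
Qed.

Lemma sobolev0_cphi l s : (0 < l)%N -> sobolev0 mu ev phi (2 * s) (cphi phi l).
Proof.
move=> l0; split; last by rewrite fourier_coef_cphi gt_eqF.
split; first by case: phi_basis.
apply: (@le_lt_trans _ _ (ev l `^ (2 * (2 * s)))%:E); last exact: ltry.
apply: lime_le.
  apply: is_cvg_nneseries => j _ _.
  by rewrite lee_fin mulr_ge0 ?sqr_ge0 ?powR_ge0.
by apply: nearW => n; rewrite sumEFin lee_fin; exact: spectral_sum_cphi_ub.
Qed.

End LaplacePowers.

(** * The multiplicative inequality, its sharpness and the equality cases *)

Theorem theorem10 (R : realType) (d : nat) (M : riemannian_manifold R d)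
    (M_compact : compact [set: M])
    (mu : {measure set (borel M) -> \bar R}) (mu_vol : is_volume_measure mu)
    (ev : nat -> R) (phi : nat -> borel M -> R)
    (spec : laplace_spectrum mu ev phi)
    (m : nat) (r lam : 'I_m.+1 -> R) (k : R)
    (r_incr : forall i j : 'I_m.+1, (i < j)%N -> r i < r j)
    (lam_gt0 : forall j, 0 < lam j)
    (lam_sum : \sum_(j < m.+1) lam j = 1)
    (k_eq : k = \sum_(j < m.+1) lam j * r j) :
  [/\ forall x : borel M -> R[i], sobolev0 mu ev phi (2 * r ord_max) x ->
        L2_norm mu (laplace_pow mu ev phi k x) <=
        \prod_(j < m.+1) L2_norm mu (laplace_pow mu ev phi (r j) x) `^ lam j,
      forall C : R,
        (forall x : borel M -> R[i], sobolev0 mu ev phi (2 * r ord_max) x ->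
          L2_norm mu (laplace_pow mu ev phi k x) <=
          C * \prod_(j < m.+1)
                L2_norm mu (laplace_pow mu ev phi (r j) x) `^ lam j) ->
        1 <= C &
      forall l : nat, (0 < l)%N ->
        sobolev0 mu ev phi (2 * r ord_max) (cphi phi l) /\
        L2_norm mu (laplace_pow mu ev phi k (cphi phi l)) =
        \prod_(j < m.+1)
          L2_norm mu (laplace_pow mu ev phi (r j) (cphi phi l)) `^ lam j].
Proof.
case: spec => _ ev1 ev_incr _ _ basis.
have ev_pos := ev_gt0 ev1 ev_incr.
have r_max j : r j <= r ord_max.
  have [->//|jm] := eqVneq j ord_max.
  by apply/ltW/r_incr; rewrite ltn_neqAle jm -ltnS ltn_ord.
(* [k] is a convex combination of the [r j]; this puts Delta^k x within the range where the spectral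
   sums are bounded. *)
have k_max : k <= r ord_max.
  rewrite k_eq -[leRHS]mul1r -lam_sum mulr_suml.
  by apply: ler_sum => j _; rewrite ler_wpM2l// ltW.
(* Both sides are powers of mu_l, and the exponents agree because k is the weighted mean of the
   [r j]. *)
have eigen l : (0 < l)%N -> L2_norm mu (laplace_pow mu ev phi k (cphi phi l)) =
    \prod_(j < m.+1)
      L2_norm mu (laplace_pow mu ev phi (r j) (cphi phi l)) `^ lam j.
  move=> l0; rewrite (laplace_pow_cphi ev basis)//.
  under eq_bigr do rewrite (laplace_pow_cphi ev basis)// -powRrM.
  rewrite prod_powR ?ev_pos// k_eq mulr_sumr.
  by congr powR; apply: eq_bigr => j _; ring.
split.
- move=> x [xs _].
  have ub s : s <= r ord_max ->
      exists B, forall n, spectral_sum mu ev phi x s n <= B.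
    by move=> sr; exact: (spectral_sum_ub ev1 ev_incr sr xs).
  set A := fun j => L2_norm mu (laplace_pow mu ev phi (r j) x).
  have A0 j : 0 <= A j by exact: L2_norm_ge0.
  (* Squaring both sides allows a comparison with spectral sums; by passage to the limit it suffices
     to bound each partial sum of exponent [k]. *)
  rewrite -ler_sqr ?nnegrE ?L2_norm_ge0 ?prodr_ge0// => [|j _]; last first.
    exact: powR_ge0.
  have -> : (\prod_(j < m.+1) A j `^ lam j) ^+ 2 =
      \prod_(j < m.+1) (A j ^+ 2) `^ lam j.
    rewrite expr2 -big_split; apply: eq_bigr => j _ /=.
    by rewrite -powRM// -expr2.
  have [B kB] := ub k k_max; have lim_k := laplace_pow_norm basis kB.
  rewrite -(cvg_lim (@Rhausdorff _) lim_k).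
  apply: limr_le; first by apply/cvg_ex; eexists; exact: lim_k.
  apply: nearW => n.
  have wA j : spectral_sum mu ev phi x (r j) n <= A j ^+ 2.
    have [B' rB] := ub (r j) (r_max j).
    exact: (spectral_sum_le_norm basis _ rB).
  (* The weighted Hoelder inequality divides by the norms, so a vanishing one is treated apart. *)
  have [[j /eqP Aj0]|A_neq0] := pselect (exists j, A j == 0).
    (* The whole spectral sum of exponent r j vanishes, hence so do all a_j. *)
    suff -> : spectral_sum mu ev phi x k n = 0.
      by apply: prodr_ge0 => i _; exact: powR_ge0.
    have w0 : spectral_sum mu ev phi x (r j) n = 0.
      apply/eqP; rewrite eq_le (le_trans (wA j)) ?Aj0 ?expr0n//=.
      by apply: sumr_ge0 => i _; rewrite mulr_ge0 ?sqr_ge0 ?powR_ge0.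
    move/eqP: w0; rewrite /spectral_sum big_nat_cond psumr_eq0; last first.
      by move=> i _; rewrite mulr_ge0 ?sqr_ge0 ?powR_ge0.
    move=> /allP w0; rewrite big_nat_cond big1_seq// => i /andP[i1n ii].
    have /implyP/(_ i1n) := w0 i ii.
    move: i1n; rewrite andbT => /andP[i1 _].
    rewrite mulf_eq0 [_ `^ _ == 0]gt_eqF ?powR_gt0 ?ev_pos// orbF => /eqP ->.
    exact: mul0r.
  have A_gt0 j : 0 < A j ^+ 2.
    rewrite exprn_gt0// lt_neqAle A0 andbT eq_sym.
    by apply/negP => Aj; apply: A_neq0; exists j.
  (* The exponent 4k is the weighted mean of the exponents 4 r_i. *)
  have -> : spectral_sum mu ev phi x k n =
      \sum_(1 <= j < n) normc (fourier_coef mu phi x j) ^+ 2 *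
        ev j `^ (\sum_(i < m.+1) lam i * (2 * (2 * r i))).
    apply: eq_bigr => j _; congr (_ * _ `^ _).
    by rewrite k_eq !mulr_sumr; apply: eq_bigr => i _; ring.
  apply: weighted_hoelder_sum => //.
  + by move=> i; exact: ltW.
  + by move=> i; exact: sqr_ge0.
  + by move=> i; rewrite mem_index_iota => /andP[/ev_pos].
(* For phi_1 the product equals the left side, a power of mu_1 > 0, which cancels. *)
- move=> C /(_ (cphi phi 1%N)).
  move=> /(_ (sobolev0_cphi ev basis (r ord_max) (isT : (0 < 1)%N))).
  rewrite -eigen//.
  rewrite (laplace_pow_cphi ev basis)// -[leLHS]mul1r ler_pM2r// powR_gt0// ev_pos.
- by move=> l l0; split; [exact: sobolev0_cphi | exact: eigen].
Qed.
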